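(* Let $n\geq 4$. Among all simple strongly connected digraphs on $n$ vertices, $\theta(0,1,n-3)$, $\theta(1,1,n-4)$ and $\theta(0,2,n-4)$ are (up to isomorphism) the digraphs which achieve the second, the third and the fourth minimum signless Laplacian spectral radius, respectively. That is, with $\overrightarrow{C_n}$ the directed cycle on $n$ vertices, $$q(\overrightarrow{C_n})<q(\theta(0,1,n-3))<q(\theta(1,1,n-4))<q(\theta(0,2,n-4))<q(D)$$ for every simple strongly connected digraph $D$ on $n$ vertices not isomorphic to any of these four digraphs.
   Context: Digraphs are finite and simple (no loops, no multiple arcs; opposite arcs allowed). $q(D)$, the signless Laplacian spectral radius, is the spectral radius of $Q(D)=\mathrm{diag}(d_1^+,\ldots,d_n^+)+A(D)$, where $d_i^+$ is the outdegree of vertex $i$ and $A(D)$ is the adjacency matrix. $\theta(a,b,c)$ denotes the digraph on $a+b+c+2$ vertices consisting of three directed paths $P_{a+2},P_{b+2},P_{c+2}$ (with $a+2$, $b+2$, $c+2$ vertices, respectively), sharing only their end vertices, such that $P_{a+2}$ and $P_{b+2}$ both start at a vertex $p$ and end at a vertex $r\neq p$, while $P_{c+2}$ starts at $r$ and ends at $p$. *)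

(* Defs.v *)
From HB Require Import structures.
From mathcomp Require Import all_boot all_order all_algebra.
From mathcomp Require Import complex.
From mathcomp Require Import classical_sets reals.

Set Implicit Arguments.
Unset Strict Implicit.
Unset Printing Implicit Defensive.

Import Order.TTheory GRing.Theory Num.Theory.

Local Open Scope ring_scope.

(* A digraph on n vertices is its arc relation on 'I_n, so multiple arcs are
   excluded by construction and simplicity is the absence of loops. *)
Definition simple_digraph n (D : rel 'I_n) : Prop := irreflexive D.

Definition strongly_connected n (D : rel 'I_n) : Prop :=
  forall x y : 'I_n, connect D x y.

Definition isomorphic m n (D : rel 'I_m) (E : rel 'I_n) : Prop :=
  exists2 f : 'I_m -> 'I_n, bijective f & forall x y, E (f x) (f y) = D x y.

Definition outdegree n (D : rel 'I_n) (x : 'I_n) : nat := #|[set y | D x y]|.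

Section SignlessLaplacian.
Variable R : realType.

Definition adjacency n (D : rel 'I_n) : 'M[R]_n := \matrix_(i, j) (D i j)%:R.

Definition signless_laplacian n (D : rel 'I_n) : 'M[R]_n :=
  diag_mx (\row_i (outdegree D i)%:R) + adjacency D.

(* The eigenvalues are the complex ones; the norm of R[i] takes values in R[i],
   hence the real part. The supremum is over a finite set, nonempty if n > 0. *)
Definition spectral_radius n (A : 'M[R]_n) : R :=
  sup [set complex.Re `|z| | z in
        [set z : R[i] | eigenvalue (map_mx (real_complex R) A) z]]%classic.

Definition q n (D : rel 'I_n) : R := spectral_radius (signless_laplacian D).

End SignlessLaplacian.

Definition dicycle n : rel 'I_n := fun x y => y == (x.+1 %% n)%N :> nat.

Definition consecutive (s : seq nat) (x y : nat) : bool :=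
  (x, y) \in zip s (behead s).

(* p is 0, r is 1, and the inner vertices of the three paths are, in path order,
   2 .. a+1, then a+2 .. a+b+1, then a+b+2 .. a+b+c+1. For a = b = 0 the two
   parallel arcs from p to r would collapse into one. *)
Definition theta a b c : rel 'I_(a + b + c + 2) := fun x y =>
  [|| consecutive (0%N :: rcons (iota 2 a) 1%N) x y,
      consecutive (0%N :: rcons (iota (2 + a) b) 1%N) x y
    | consecutive (1%N :: rcons (iota (2 + a + b) c) 0%N) x y].

Arguments dicycle : clear implicits.
Arguments theta : clear implicits.

(* Main.v *)
From mathcomp Require Import classical_sets topology normedtype derive.
Require Import Defs.
From mathcomp Require Import all_boot all_order all_algebra complex.
From mathcomp Require Import reals ring lra zify.
Set Implicit Arguments.
Unset Strict Implicit.
Unset Printing Implicit Defensive.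
Import Order.TTheory GRing.Theory Num.Theory.
Import numFieldTopology.Exports numFieldNormedType.Exports.
Local Open Scope ring_scope.

(** Put s = q(D) - 1 and let x be the Perron vector of Q(D). At a vertex of
    outdegree one, s x(v) = x(v'), where v' is the out-neighbour, so along the
    forced walk of length h(v) from v to the first branching vertex u we get
    s^h(v) x(v) = x(u). If s < 2, branching vertices have outdegree exactly two;
    at the one minimizing x, with out-neighbours f and g, this gives
      (s - 1) s^(n-1) >= s^(n-1-h(f)) + s^(n-1-h(g)),
    with equality if it is the only branching vertex. For theta(a,b,c) with
    a <= b the right-hand side is s^a + s^b, that is s + 1, 2s and s^2 + 1 for
    the three digraphs of the theorem. As the walks visit distinct nonbranching
    vertices, their lengths make the right-hand side exceed s^2 + 1, except in
    three configurations, in which D is one of these thetas. *)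

(** * Perron vectors of irreducible nonnegative matrices *)

(** The admissible pairs [(mu, y)] with [mu >= 0] form a compact set [K], on which the first
    projection attains its maximum. *)
Lemma collatz_wielandt_max (R : realType) n (A : 'M[R]_n.+1) :
  (forall i j, 0 <= A i j) ->
  exists (lam : R) (x : 'I_n.+1 -> R),
    [/\ forall i, 0 <= x i, \sum_i x i = 1,
        forall i, lam * x i <= \sum_j A i j * x j
      & forall (mu : R) (y : 'I_n.+1 -> R), (forall i, 0 <= y i) ->
          \sum_i y i = 1 -> (forall i, mu * y i <= \sum_j A i j * y j) ->
          mu <= lam].
Proof.
move=> A0.
(* Summing [mu * y i <= (A y) i] over [i], with [y] of sum 1 and entries at most 1, bounds [mu] by
   [C]. *)
pose C := \sum_i \sum_j A i j.
have C0 : 0 <= C by apply: sumr_ge0 => i _; apply: sumr_ge0.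
pose box : set (R * 'rV[R]_n.+1) :=
  (`[0, C] `*`
   [set v : 'rV[R]_n.+1 | forall i, `[0, 1]%classic (v ord0 i)])%classic.
pose simplex : set (R * 'rV[R]_n.+1) :=
  ((fun p : R * 'rV[R]_n.+1 => \sum_i p.2 ord0 i - 1) @^-1` [set z | 0 <= z] `&`
   (fun p : R * 'rV[R]_n.+1 => \sum_i p.2 ord0 i - 1)
     @^-1` [set z | z <= 0])%classic.
pose sup_eigen i : set (R * 'rV[R]_n.+1) :=
  ((fun p : R * 'rV[R]_n.+1 => \sum_j A i j * p.2 ord0 j - p.1 * p.2 ord0 i)
     @^-1` [set z | 0 <= z])%classic.
pose K := (box `&` (simplex `&` \bigcap_i sup_eigen i))%classic.
have coordC i : continuous (fun p : R * 'rV[R]_n.+1 => p.2 ord0 i).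
  move=> p; apply: (@continuous_comp _ _ _ snd (fun v : 'rV[R]_n.+1 => v ord0 i)).
    exact: cvg_snd.
  exact: coord_continuous.
have sumC : continuous (fun p : R * 'rV[R]_n.+1 => \sum_i p.2 ord0 i - 1).
  move=> p; apply: cvgB; last exact: cvg_cst.
  by apply: continuous_big; [exact: add_continuous | move=> i _; exact: coordC].
have cK : compact K.
  apply: compact_closedI.
    apply: compact_setX; first exact: segment_compact.
    have := @rV_compact R n.+1 (fun=> `[0, 1]%classic)
      (fun=> @segment_compact R 0 1).
    exact.
  apply: closedI.
    apply: closedI; apply: preimage_closed.
    - by move=> p _; exact: sumC.
    - exact: closed_ge.
    - by move=> p _; exact: sumC.
    - exact: closed_le.
  apply: closed_bigI => i _; apply: preimage_closed; last exact: closed_ge.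
  move=> p _; apply: cvgB.
    apply: continuous_big; first exact: add_continuous.
    move=> j _ q; apply: cvgM; [exact: cvg_cst | exact: coordC].
  by apply: cvgM; [exact: cvg_fst | exact: coordC].
have KP (mu : R) (y : 'I_n.+1 -> R) : 0 <= mu -> (forall i, 0 <= y i) ->
    \sum_i y i = 1 -> (forall i, mu * y i <= \sum_j A i j * y j) ->
    K (mu, \row_i y i).
  move=> mu0 y0 y1 yA.
  have y_le1 i : y i <= 1 by rewrite -y1 (bigD1 i) //= lerDl sumr_ge0.
  split; first split => /=.
  - rewrite in_itv /= mu0 /= -[mu]mulr1 -y1 mulr_sumr.
    apply: ler_sum => i _; apply: le_trans (yA i) _; apply: ler_sum => j _.
    by rewrite -[leRHS]mulr1 ler_wpM2l.
  - by move=> i; rewrite mxE in_itv /= y0 y_le1.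
  - split.
      by split; rewrite /= (eq_bigr y) ?y1 ?subrr // => i _; rewrite mxE.
    move=> i _; rewrite /sup_eigen /= mxE subr_ge0.
    by under eq_bigr do rewrite mxE.
have [||p pK p_max] := @compact_EVT_max _ R fst K _ cK.
- exists (0, \row_i (i == ord0)%:R); apply: KP => //.
  + by rewrite (bigD1 ord0) //= big1 ?addr0 // => i /negPf->.
  + move=> i; rewrite mul0r; apply: sumr_ge0 => j _.
    by rewrite mulr_ge0 ?ler0n.
- by apply: continuous_subspaceT => q; exact: cvg_fst.
have [[/= p1 p2] [[/= ge1 le1] eig]] := set_mem pK.
exists p.1, (p.2 ord0); split.
- by move=> i; have := p2 i; rewrite /= in_itv /= => /andP[].
- by apply/eqP; rewrite -subr_eq0 eq_le ge1 le1.
- by move=> i; have := eig i I; rewrite /sup_eigen /= subr_ge0.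
(* Pairs with [mu < 0] lie outside [K], but the maximum itself is nonnegative. *)
- move=> mu y y0 y1 yA; case: (leP 0 mu) => [mu0|mu_lt0].
    by apply: (p_max (mu, \row_i y i)); apply/mem_set/KP.
  move: p1; rewrite in_itv /= => /andP[p1 _].
  exact: le_trans (ltW mu_lt0) p1.
Qed.

(** Applying [1 + A] preserves positive entries and spreads positivity backwards along one arc. A
    path without repeated vertices has fewer than [n] arcs, so [n] rounds reach every index. *)
Lemma iter_addmx_gt0 (R : numDomainType) n (A : 'M[R]_n) (v : 'cV[R]_n) :
  (forall i j, 0 <= A i j) ->
  (forall i j, connect [rel i j | 0 < A i j] i j) ->
  (forall i, 0 <= v i 0) -> v != 0 ->
  forall i, 0 < iter n (fun u => u + A *m u) v i 0.
Proof.
move=> A0 irr v0 vN0 i; set T := fun u => _.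
have Av0 (u : 'cV[R]_n) : (forall k, 0 <= u k 0) ->
    forall k, 0 <= (A *m u) k (0 : 'I_1).
  by move=> u0 k; rewrite mxE sumr_ge0 // => j _; rewrite mulr_ge0.
have T0 m k : 0 <= iter m T v k 0.
  by elim: m k => [|m IH] k //=; rewrite mxE addr_ge0 // Av0.
have [j vj] : exists j, 0 < v j 0.
  have [j vjN0] : exists j, v j 0 != 0.
    apply/existsP; apply: contraNT vN0 => /existsPn v_eq0.
    apply/eqP/matrixP => k l; rewrite mxE ord1; apply/eqP.
    by have := v_eq0 k; rewrite negbK.
  by exists j; rewrite lt_def vjN0 v0.
have pos_path p k : path [rel i j | 0 < A i j] k p -> last k p = j ->
    0 < iter (size p) T v k 0.
  elim: p k => [|l p IH] k /=; first by move=> _ ->.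
  case/andP=> Akl lp pj; rewrite mxE ltr_wpDl //.
  rewrite mxE (bigD1 l) //= ltr_wpDr ?mulr_gt0 ?IH //.
  by rewrite sumr_ge0 // => ? _; rewrite mulr_ge0.
have pos_mono m m' : (m <= m')%N -> 0 < iter m T v i 0 -> 0 < iter m' T v i 0.
  elim: m' => [|m' IH]; first by rewrite leqn0 => /eqP->.
  rewrite leq_eqVlt => /predU1P[-> //|/IH{}IH /IH m'_gt0].
  by rewrite /= mxE ltr_wpDr ?Av0.
have /connectP[p0 /shortenP[p pth p_uniq _] pj] := irr i j.
apply: (pos_mono (size p)); last exact: pos_path.
by have := max_card [in i :: p]; rewrite (card_uniqP p_uniq) card_ord => /ltnW.
Qed.

(** Start from the Collatz-Wielandt maximizer [x], with defect [d = A x - lam x >= 0]. Since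
    [T = 1 + A] commutes with [A], the defect of [T^m x] is [T^m d]. If [d = 0], then the positive
    vector [z] is a multiple of [x], which is therefore positive. *)
Lemma perron_vector (R : realType) n (A : 'M[R]_n.+1) :
  (forall i j, 0 <= A i j) ->
  (forall i j, connect [rel i j | 0 < A i j] i j) ->
  exists lam, exists2 x : 'I_n.+1 -> R,
    forall i, 0 < x i & forall i, \sum_j A i j * x j = lam * x i.
Proof.
move=> A0 irr; have [lam [x [x0 x1 Ax lam_max]]] := collatz_wielandt_max A0.
pose v : 'cV[R]_n.+1 := \col_i x i.
have v0 i : 0 <= v i 0 by rewrite mxE.
have vN0 : v != 0.
  apply/eqP => v_eq0; have := oner_neq0 R; rewrite -x1 big1 ?eqxx // => i _.
  by move/matrixP: v_eq0 => /(_ i 0); rewrite !mxE.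
pose T u : 'cV[R]_n.+1 := u + A *m u.
pose z := iter n.+1 T v; pose d := A *m v - lam *: v.
have z0 i : 0 < z i 0 by exact: iter_addmx_gt0.
have Tcomm m : A *m iter m T v - lam *: iter m T v = iter m T d.
  elim: m => [|m IH] //=; rewrite -IH /T mulmxDr mulmxBr scalerDr -scalemxAr.
  by rewrite opprD addrACA.
have d0 i : 0 <= d i 0.
  rewrite !mxE subr_ge0; apply: le_trans (Ax i) _.
  by under [leRHS]eq_bigr do rewrite mxE.
have [d_eq0|dN0] := eqVneq d 0.
  have Av : A *m v = lam *: v by apply/eqP; rewrite -subr_eq0 -/d d_eq0.
  exists lam, x => i; last first.
    by move/matrixP: Av => /(_ i 0); rewrite !mxE; under eq_bigr do rewrite mxE.
  have Tv m : iter m T v = (1 + lam) ^+ m *: v.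
    elim: m => [|m IH] /=; first by rewrite expr0 scale1r.
    by rewrite IH /T -scalemxAr Av !scalerA -scalerDl exprSr mulrDr mulr1.
  have := z0 i; rewrite /z Tv !mxE lt_def mulf_eq0 negb_or => /andP[/andP[_ xi] _].
  by rewrite lt_def xi x0.
(* Otherwise applying the positive map [iter n.+1 T] makes the inequality strict
   everywhere, so that [lam] could be increased. *)
exfalso; have Az i : lam * z i 0 < (A *m z) i 0.
  rewrite -subr_gt0.
  have -> : (A *m z) i 0 - lam * z i 0 = (A *m z - lam *: z) i 0 by rewrite !mxE.
  by rewrite Tcomm; apply: iter_addmx_gt0.
(* The smallest ratio [r k] exceeds [lam], yet [z] scaled to sum 1 is admissible for it. *)
pose r i := (A *m z) i 0 / z i 0.
pose k := [arg min_(i < ord0) r i]%O.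
have rk i : r k <= r i by rewrite /k; case: arg_minP => // j _; apply.
have sigma0 : 0 < \sum_i z i 0.
  by rewrite (bigD1 ord0) //= ltr_wpDr // sumr_ge0 // => i _; exact: ltW.
suff: r k <= lam by rewrite leNgt /r ltr_pdivlMr ?Az.
apply: (lam_max (r k) (fun i => z i 0 / \sum_i z i 0)).
- by move=> i; rewrite divr_ge0 ?ltW.
- by rewrite -mulr_suml divff // gt_eqF.
- move=> i; under [leRHS]eq_bigr do rewrite mulrA; rewrite -mulr_suml mulrA.
  rewrite ler_wpM2r ?invr_ge0 ?(ltW sigma0) //.
  by have := rk i; rewrite {2}/r ler_pdivlMr // [X in _ <= X -> _]mxE.
Qed.

(** [eigenvalue] refers to row vectors acting from the left, whereas the Perron vectors here are
    right eigenvectors. *)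
Lemma eigenvalue_tr (F : fieldType) n (A : 'M[F]_n) a :
  eigenvalue A^T a = eigenvalue A a.
Proof.
rewrite /eigenvalue /eigenspace !kermx_eq0 !row_free_unit.
by rewrite -[A^T - _]trmxK unitmx_tr linearB /= trmxK tr_scalar_mx.
Qed.

(** If [v] is a left eigenvector for a complex eigenvalue [z], the triangle inequality gives
    [|z| |v| <= |v| A] entrywise. Pairing with the positive right eigenvector [x] turns the
    right-hand side into [lam] times the pairing of [|v|] with [x], which is positive, so
    [|z| <= lam]. *)
Lemma spectral_radius_pos_eigenvector (R : realType) n (A : 'M[R]_n) lam
    (x : 'I_n -> R) :
  (0 < n)%N -> (forall i j, 0 <= A i j) -> (forall i, 0 < x i) ->
  (forall i, \sum_j A i j * x j = lam * x i) -> spectral_radius A = lam.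
Proof.
case: n A x => // n A x _ A0 x0 Ax.
have lam0 : 0 <= lam.
  rewrite -(pmulr_lge0 _ (x0 ord0)) -Ax sumr_ge0 // => j _.
  by rewrite mulr_ge0 // ltW.
pose S := [set complex.Re `|z| | z in
        [set z : R[i] | eigenvalue (map_mx (real_complex R) A) z]]%classic.
have Slam : S lam.
  exists (real_complex R lam) .
    rewrite /mkset eigenvalue_map -eigenvalue_tr; apply/eigenvalueP.
    exists (\row_i x i).
      apply/rowP => i; rewrite !mxE -Ax.
      by apply: eq_bigr => j _; rewrite !mxE mulrC.
    by apply/eqP => /rowP/(_ ord0); rewrite !mxE; apply/eqP; rewrite gt_eqF.
  by rewrite normc_def /= expr0n addr0 sqrtr_sqr ger0_norm.
have Sub : ubound S lam.
  move=> _ [z /eigenvalueP[v vA vN0] <-].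
  pose w i := complex.Re `|v 0 i|.
  have wE i : (w i)%:C%C = `|v 0 i| by rewrite /w normc_def.
  set nz := complex.Re `|z|; have nzE : nz%:C%C = `|z| by rewrite /nz normc_def.
  have nw i : nz * w i <= \sum_j w j * A j i.
    rewrite -lecR rmorphM rmorph_sum /= nzE wE -normrM.
    have -> : z * v 0 i = \sum_j v 0 j * (A j i)%:C%C.
      move/rowP: vA => /(_ i); rewrite !mxE => <-.
      by apply: eq_bigr => j _; rewrite mxE.
    apply: le_trans (ler_norm_sum _ _ _) _; apply: ler_sum => j _.
    by rewrite normrM rmorphM /= wE ler_wpM2l // ger0_norm // lecR.
  have w0 i : 0 <= w i by rewrite -lecR wE; exact: normr_ge0.
  have [k wk] : exists k, 0 < w k.
    have [k vk] : exists k, v 0 k != 0.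
      apply/existsP; apply: contraNT vN0 => /existsPn v_eq0.
      apply/eqP/rowP => k; rewrite mxE; apply/eqP.
      by have := v_eq0 k; rewrite negbK.
    by exists k; rewrite -ltcR wE rmorph0 normr_gt0.
  have s0 : 0 < \sum_i w i * x i.
    rewrite (bigD1 k) //= ltr_wpDr ?mulr_gt0 // sumr_ge0 // => i _.
    by rewrite mulr_ge0 // ltW.
  rewrite -(ler_pM2r s0) !mulr_sumr.
  apply: (@le_trans _ _ (\sum_i \sum_j w j * A j i * x i)).
    by apply: ler_sum => i _; rewrite mulrA -mulr_suml ler_wpM2r // ltW.
  rewrite exchange_big /=; apply: ler_sum => j _.
  rewrite mulrCA -Ax mulr_sumr; apply: ler_sum => i _.
  by rewrite mulrA.
rewrite /spectral_radius -/S; apply/eqP; rewrite eq_le; apply/andP; split.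
  by apply: ge_sup => //; exists lam.
by apply: ub_le_sup => //; exists lam.
Qed.

(** * Signless Laplacians and digraphs branching at the root only *)

Definition perron_eigenvector (R : realType) n (D : rel 'I_n) (lam : R)
    (x : 'I_n -> R) :=
  (forall i, 0 < x i) /\
  forall i, (outdegree D i)%:R * x i + \sum_(j | D i j) x j = lam * x i.

Lemma signless_laplacian_mul (R : realType) n (D : rel 'I_n) (x : 'I_n -> R) i :
  \sum_j signless_laplacian R D i j * x j =
  (outdegree D i)%:R * x i + \sum_(j | D i j) x j.
Proof.
under eq_bigr => j _ do rewrite !mxE mulrDl.
rewrite big_split /=; congr (_ + _).
  rewrite (bigD1 i) //= eqxx mulr1n big1 ?addr0 // => j /negPf.
  by rewrite eq_sym => ->; rewrite mulr0n mul0r.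
rewrite [RHS]big_mkcond; apply: eq_bigr => j _.
by case: (D i j); rewrite ?mul1r ?mul0r.
Qed.

Lemma signless_laplacian_ge0 (R : realType) n (D : rel 'I_n) i j :
  0 <= signless_laplacian R D i j.
Proof. by rewrite !mxE addr_ge0 ?mulrn_wge0 ?ler0n. Qed.

Lemma q_perron_eigenvector (R : realType) n (D : rel 'I_n) (lam : R) x :
  (0 < n)%N -> perron_eigenvector D lam x -> q R D = lam.
Proof.
move=> n0 [x0 Dx]; apply: (spectral_radius_pos_eigenvector n0 _ x0) => [i j|i].
  exact: signless_laplacian_ge0.
by rewrite signless_laplacian_mul.
Qed.

Lemma ex_perron_eigenvector (R : realType) n (D : rel 'I_n) :
  (0 < n)%N -> strongly_connected D -> exists x, perron_eigenvector D (q R D) x.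
Proof.
case: n D => // n D _ sD.
have [|i j|lam [x x0 Qx]] := @perron_vector R n (signless_laplacian R D).
- exact: signless_laplacian_ge0.
- apply: connect_sub (sD i j) => k l /= Dkl; apply: connect1 => /=.
  by rewrite !mxE Dkl ltr_wpDl ?ltr01 ?mulrn_wge0.
- have Dx : perron_eigenvector D lam x.
    by split=> // i; rewrite -Qx signless_laplacian_mul.
  by exists x; rewrite (q_perron_eigenvector _ Dx).
Qed.

Lemma isomorphic_sym m n (D : rel 'I_m) (E : rel 'I_n) :
  isomorphic D E -> isomorphic E D.
Proof.
case=> f [g fK gK] Df; exists g; first by exists f.
by move=> x y; rewrite -Df !gK.
Qed.

Lemma isomorphic_trans l m n (D : rel 'I_l) (E : rel 'I_m) (F : rel 'I_n) :
  isomorphic D E -> isomorphic E F -> isomorphic D F.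
Proof.
case=> f bij_f Df [g bij_g Eg]; exists (g \o f); first exact: bij_comp.
by move=> x y /=; rewrite Eg Df.
Qed.

Lemma isomorphic_simple m n (D : rel 'I_m) (E : rel 'I_n) :
  isomorphic D E -> simple_digraph D -> simple_digraph E.
Proof. by case=> f [g fK gK] Df sD x; rewrite -[x]gK Df sD. Qed.

Lemma isomorphic_strongly_connected m n (D : rel 'I_m) (E : rel 'I_n) :
  isomorphic D E -> strongly_connected D -> strongly_connected E.
Proof.
case=> f [g fK gK] Df sD x y; rewrite -[x]gK -[y]gK.
have /connectP[p pth ->] := sD (g x) (g y).
elim: p (g x) pth => [|z p IH] u /= ; first by rewrite connect0.
by case/andP=> Duz /IH; apply: connect_trans; rewrite connect1 ?Df.
Qed.

Lemma isomorphic_perron_eigenvector (R : realType) m n (D : rel 'I_m)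
    (E : rel 'I_n) f (lam : R) x :
  bijective f -> (forall u v, E (f u) (f v) = D u v) ->
  perron_eigenvector E lam x -> perron_eigenvector D lam (x \o f).
Proof.
move=> bij_f Df [x0 Ex]; split=> [i|i] /=; first exact: x0.
rewrite -Ex; congr (_%:R * _ + _).
  rewrite /outdegree -(card_imset _ (bij_inj bij_f)); apply: eq_card => u.
  have [g _ gK] := bij_f; rewrite inE -{1 2}[u]gK mem_imset ?inE ?Df //.
  exact: bij_inj.
rewrite [RHS](reindex f) /=; last exact: onW_bij.
by apply: eq_bigl => j; rewrite Df.
Qed.

(** A Perron vector of [E], pulled back along the isomorphism, is one of [D] for the same
    eigenvalue. *)
Lemma isomorphic_q (R : realType) m n (D : rel 'I_m) (E : rel 'I_n) :
  (0 < m)%N -> isomorphic D E -> strongly_connected E -> q R D = q R E.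
Proof.
move=> m0 [f bij_f Df] sE.
have n0 : (0 < n)%N by case: (f (Ordinal m0)) => k; exact: leq_ltn_trans.
have [x Ex] := ex_perron_eigenvector R n0 sE.
exact: q_perron_eigenvector (isomorphic_perron_eigenvector bij_f Df Ex).
Qed.

(* The vertex 0 is the only one that may branch; every other vertex has its
   parent as unique out-neighbour. Numbering a digraph in this way by distance to
   the branching vertex brings it into a normal form. *)
Definition rooted_digraph n (S : seq nat) (par : nat -> nat) : rel 'I_n :=
  fun i j => if i == 0%N :> nat then (j : nat) \in S else j == par i :> nat.
Arguments rooted_digraph : clear implicits.

(** Parents decrease, so every vertex leads down to 0. Conversely, a vertex other than 0 is an
    out-neighbour of 0 or the parent of a larger vertex, so induction on [n - j] reaches it from
    0. *)
Lemma rooted_digraph_strongly_connected n S par :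
  (forall i, 0 < i < n -> par i < i)%N ->
  (forall j, 0 < j < n -> j \in S \/ exists2 i, j < i < n & par i = j)%N ->
  strongly_connected (rooted_digraph n S par).
Proof.
move=> par_lt par_onto.
have to0 (i j : 'I_n) : j = 0%N :> nat -> connect (rooted_digraph n S par) i j.
  move=> j0; have [k] := ubnP (i : nat); elim: k i => // k IH i.
  rewrite ltnS => ik; have [i0|iN0] := posnP (i : nat).
    by have -> : i = j by apply: val_inj; rewrite /= i0 j0.
  have pi : (par i < i)%N by apply: par_lt; rewrite iN0 ltn_ord.
  apply: connect_trans (IH (Ordinal (ltn_trans pi (ltn_ord i))) _).
    by apply: connect1; rewrite /rooted_digraph gtn_eqF /=.
  exact: leq_trans pi ik.
have from0 (i j : 'I_n) : i = 0%N :> nat -> connect (rooted_digraph n S par) i j.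
  move=> i0; have [k] := ubnP (n - j); elim: k j => // k IH j.
  rewrite ltnS => jk; have [j0|jN0] := posnP (j : nat).
    by have -> : i = j by apply: val_inj; rewrite /= i0 j0.
  have [|jS|[l /andP[jl ln] lj]] := par_onto j; first by rewrite jN0 ltn_ord.
    by apply: connect1; rewrite /rooted_digraph i0.
  apply: connect_trans (IH (Ordinal ln) _) _ => /=; first by lia.
  by apply: connect1; rewrite /rooted_digraph /= gtn_eqF ?lj //=; lia.
move=> x y; have n0 : (0 < n)%N by exact: leq_ltn_trans (ltn_ord x).
apply: (@connect_trans _ _ (Ordinal n0)); [exact: to0 | exact: from0].
Qed.

Lemma isomorphic_rooted_digraph n (D : rel 'I_n) S par (H : 'I_n -> nat) p nx :
  (forall v, H v < n)%N -> injective H -> H p = 0%N ->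
  (forall v, D p v = (H v \in S)) ->
  (forall u v, u != p -> D u v = (v == nx u)) ->
  (forall u, u != p -> H (nx u) = par (H u)) ->
  isomorphic D (rooted_digraph n S par).
Proof.
move=> H_lt H_inj Hp DpE DE Hnx; exists (fun v => Ordinal (H_lt v)).
  by apply: injF_bij => u v /(congr1 val); exact: H_inj.
move=> u v; rewrite /rooted_digraph /= -Hp (inj_eq H_inj).
have [->|up] := eqVneq u p; first by rewrite DpE.
by rewrite DE // -Hnx // (inj_eq H_inj).
Qed.

(* Two root arcs: multiplying the equation at the root by [s ^+ N] turns it
   into a polynomial equation for [s = q - 1]. *)
Lemma rooted_digraph_q (R : realType) n (a b N : nat) par (ht : nat -> nat) :
  let D := rooted_digraph n [:: a; b] par in
  strongly_connected D -> (0 < b)%N -> (b < a < n)%N ->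
  (ht a <= N)%N -> (ht b <= N)%N ->
  (forall i, 0 < i < n -> par i < i)%N -> ht 0%N = 0%N ->
  (forall i, 0 < i < n -> ht i = (ht (par i)).+1)%N ->
  let s := q R D - 1 in
  1 < s /\ (s - 1) * s ^+ N = s ^+ (N - ht a) + s ^+ (N - ht b).
Proof.
move=> D sD b0 /andP[ba an] haN hbN par_lt ht0 htS s.
have n0 : (0 < n)%N by exact: leq_ltn_trans an.
have [x [x0 Dx]] := ex_perron_eigenvector R n0 sD.
pose r := Ordinal n0; pose oa := Ordinal an; pose ob := Ordinal (ltn_trans ba an).
have xht (i : 'I_n) : x i * s ^+ ht i = x r.
  have [k] := ubnP (i : nat); elim: k i => // k IH i; rewrite ltnS => ik.
  have [i0|iN0] := posnP (i : nat).
    have -> : i = r by exact: val_inj.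
    by rewrite ht0 expr0 mulr1.
  have i_n : (0 < i < n)%N by rewrite iN0 ltn_ord.
  have pi := par_lt _ i_n; pose pari := Ordinal (ltn_trans pi (ltn_ord i)).
  rewrite -(IH pari) /=; last exact: leq_trans pi ik.
  have Di j : D i j = (j == pari) by rewrite /D /rooted_digraph gtn_eqF.
  have := Dx i; rewrite (eq_bigl _ _ Di) big_pred1_eq.
  have -> : outdegree D i = 1%N.
    by rewrite -(cards1 pari); apply: eq_card => j; rewrite !inE Di.
  by rewrite htS // => xi; rewrite exprS mulrA; congr (_ * _); rewrite /s; lra.
have Dr j : D r j = (j == oa) || (j == ob) by rewrite /D /rooted_digraph /= !inE.
have ab : oa != ob by rewrite -val_eqE /= gtn_eqF.
have := Dx r; have -> : outdegree D r = 2%N.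
  have <- : #|[set oa; ob]| = 2%N by rewrite cards2 ab.
  by apply: eq_card => j; rewrite !inE Dr.
rewrite (eq_bigl _ _ Dr) (bigD1 oa) ?eqxx //= (big_pred1 ob); last first.
  by move=> j /=; have [->|] := eqVneq j oa; rewrite ?(negPf ab) //= andbT.
move=> root_eq.
(* The root has outdegree two, so its equation reads [(s - 1) * x r = x oa + x ob], with positive
   right-hand side. *)
have s1 : 1 < s.
  have xa := x0 oa; have xb := x0 ob; rewrite -subr_gt0 -(pmulr_lgt0 _ (x0 r)).
  by rewrite /s; lra.
split=> //; apply: (mulIf (lt0r_neq0 (x0 r))).
have -> : (s - 1) * s ^+ N * x r = (x oa + x ob) * s ^+ N.
  by rewrite mulrAC; congr (_ * _); rewrite /s; lra.
rewrite !mulrDl -{1}(xht oa) -(xht ob) /= ![_ ^+ _ * (_ * _)]mulrCA -!exprD.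
by rewrite !subnK.
Qed.

(** * The four minimal digraphs *)

(** This turns the list encoding of a path into linear arithmetic, where case analysis and [lia]
    apply. *)
Lemma consecutive_iota u m c v x y :
  consecutive (u :: rcons (iota m c) v) x y =
  ((x == u) && ((c == 0) && (y == v) || (0 < c) && (y == m)) ||
   [&& m <= x, x < m + c &
       (x.+1 == m + c) && (y == v) || (x.+1 < m + c) && (y == x.+1)])%N.
Proof.
elim: c u m => [|c IH] u m; first by rewrite /consecutive /= inE xpair_eqE; lia.
have := IH m m.+1; rewrite /consecutive /= inE xpair_eqE => ->.
by lia.
Qed.

(** [L] translates the numbers of the normal form into the labels of [theta]. The vertices [u] and
    [v] are tied to [L i] and [L j] by equations in [nat] because the two ordinal types are equal
    only through the first hypothesis. *)
Lemma isomorphic_rooted_theta n a b c S par (L : nat -> nat) :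
  (a + b + c + 2 = n)%N -> (forall i, i < n -> L i < n)%N ->
  (forall i j, i < n -> j < n -> L i = L j -> i = j)%N ->
  (forall (i j : 'I_n) (u v : 'I_(a + b + c + 2)),
     u = L i :> nat -> v = L j :> nat ->
     theta a b c u v = rooted_digraph n S par i j) ->
  isomorphic (theta a b c) (rooted_digraph n S par).
Proof.
move=> abc; case: _ / abc => L_lt L_inj thetaE; apply: isomorphic_sym.
exists (fun i : 'I_(a + b + c + 2) => Ordinal (L_lt i (ltn_ord i))); last first.
  by move=> i j; apply: thetaE.
by apply: injF_bij => i j /(congr1 val) /= /L_inj => ij; apply: val_inj; apply: ij.
Qed.

(** In theta(1,1,n-4) both out-neighbours of the root are at distance [n - 2] from it. One of the
    twins receives the free number [n.-1], and both have parent [n - 3]. *)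
Definition theta11_parent n i := if (i == n.-1)%N then (n - 3)%N else i.-1.

(** On the cycle the distance from [i] to 0 is [n - i] for [i > 0], so the normal form reverses the
    labels. *)
Lemma dicycle_rooted n : (0 < n)%N ->
  isomorphic (dicycle n) (rooted_digraph n [:: n.-1] predn).
Proof.
move=> n0; have lt i : ((if i == 0 then 0 else n - i) < n)%N by case: ifP; lia.
apply: isomorphic_sym; exists (fun i : 'I_n => Ordinal (lt i)).
  apply: injF_bij => i j /(congr1 val) /= ij; apply: val_inj => /=.
  by move: ij (ltn_ord i) (ltn_ord j); repeat case: eqP; lia.
move=> i j; rewrite /dicycle /rooted_digraph /= inE.
move: (ltn_ord i) (ltn_ord j); have [->|i0] /= := eqVneq (i : nat) 0%N.
  have [n1|n1] := leqP n 1.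
    have -> : (1 %% n = 0)%N by have -> : n = 1%N by lia.
    by case: ifP; lia.
  by rewrite modn_small; [case: ifP; lia | lia].
have [i1|i1] := eqVneq (i : nat) 1%N.
  by rewrite i1 subn1 prednK // modnn; case: ifP; lia.
by move=> i_n j_n; rewrite modn_small; [case: ifP; lia | lia].
Qed.

(* [lia] alone does not terminate in reasonable time on the equivalences of large
   boolean combinations below, but it settles their atoms one by one. *)
Ltac decide_atoms :=
  repeat (match goal with
  | |- context [if @eq_op ?T ?a ?b then _ else _] =>
      case: (@eqP T a b) => ?; try (exfalso; lia)
  | |- context [@eq_op ?T ?a ?b] => first
      [ have -> : (@eq_op T a b) = true by lia
      | have -> : (@eq_op T a b) = false by lia
      | case: (@eqP T a b) => ? ]
  | |- context [leq ?a ?b] => first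
      [ have -> : leq a b = true by lia
      | have -> : leq a b = false by lia
      | case: (leqP a b) => ? ]
  end; rewrite /= ?andbF ?orbF ?andbT ?orbT).

Lemma theta01_rooted n : (4 <= n)%N ->
  isomorphic (theta 0 1 (n - 3)) (rooted_digraph n [:: n.-1; n - 2] predn)%N.
Proof.
(* The cycle of length [n] runs through the labels 0, 2, 1, 3, 4, and so on; [L] reads it backwards,
   by distance to 0. [LP] tabulates [L] for the case analysis. *)
move=> n4; pose L i :=
  (if i == 0 then 0 else
   if i == n.-1 then 2 else
   if i == n - 2 then 1 else n - i)%N.
have LP i : (i < n ->
    i = 0 /\ L i = 0 \/
    i = n.-1 /\ L i = 2 \/
    i = n - 2 /\ L i = 1 \/
    0 < i < n - 2 /\ L i = n - i)%N.
  by rewrite /L; repeat case: eqP => ?; lia.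
apply: (@isomorphic_rooted_theta _ _ _ _ _ _ L) => [|i i_n|i j i_n j_n|].
- lia.
- by have := LP i i_n; lia.
- by have := LP i i_n; have := LP j j_n; lia.
- move=> i j u v ui vj; rewrite /theta ui vj !consecutive_iota /rooted_digraph !inE.
  have := LP i (ltn_ord i); have := LP j (ltn_ord j).
  move: (i : nat) (j : nat) (L i) (L j) => {ui vj LP L u v} {}i {}j li lj.
  by move=> [[-> ->]|[[-> ->]|[[-> ->]|[? ->]]]]
            [[-> ->]|[[-> ->]|[[-> ->]|[? ->]]]];
    decide_atoms.
Qed.

Lemma theta11_rooted n : (4 <= n)%N ->
  isomorphic (theta 1 1 (n - 4))
    (rooted_digraph n [:: n.-1; n - 2] (theta11_parent n))%N.
Proof.
(* The twins are the labels 2 and 3, the inner vertices of the two parallel paths; both precede the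
   label 1. *)
move=> n4; pose L i :=
  (if i == 0 then 0 else
   if i == n.-1 then 3 else
   if i == n - 2 then 2 else
   if i == n - 3 then 1 else n - i)%N.
have LP i : (i < n ->
    i = 0 /\ L i = 0 \/
    i = n.-1 /\ L i = 3 \/
    i = n - 2 /\ L i = 2 \/
    i = n - 3 /\ L i = 1 \/
    0 < i < n - 3 /\ L i = n - i)%N.
  by rewrite /L; repeat case: eqP => ?; lia.
apply: (@isomorphic_rooted_theta _ _ _ _ _ _ L) => [|i i_n|i j i_n j_n|].
- lia.
- by have := LP i i_n; lia.
- by have := LP i i_n; have := LP j j_n; lia.
- move=> i j u v ui vj; rewrite /theta ui vj !consecutive_iota.
  rewrite /rooted_digraph !inE /theta11_parent.
  have := LP i (ltn_ord i); have := LP j (ltn_ord j).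
  move: (i : nat) (j : nat) (L i) (L j) => {ui vj LP L u v} {}i {}j li lj.
  by move=> [[-> ->]|[[-> ->]|[[-> ->]|[[-> ->]|[? ->]]]]]
            [[-> ->]|[[-> ->]|[[-> ->]|[[-> ->]|[? ->]]]]];
    decide_atoms.
Qed.

Lemma theta02_rooted n : (4 <= n)%N ->
  isomorphic (theta 0 2 (n - 4)) (rooted_digraph n [:: n.-1; n - 3] predn)%N.
Proof.
(* Here the cycle of length [n] runs through 0, 2, 3, 1, 4, 5, and so on, and the chord from 0 to 1
   meets it at distance [n - 3] from 0. *)
move=> n4; pose L i :=
  (if i == 0 then 0 else
   if i == n.-1 then 2 else
   if i == n - 2 then 3 else
   if i == n - 3 then 1 else n - i)%N.
have LP i : (i < n ->
    i = 0 /\ L i = 0 \/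
    i = n.-1 /\ L i = 2 \/
    i = n - 2 /\ L i = 3 \/
    i = n - 3 /\ L i = 1 \/
    0 < i < n - 3 /\ L i = n - i)%N.
  by rewrite /L; repeat case: eqP => ?; lia.
apply: (@isomorphic_rooted_theta _ _ _ _ _ _ L) => [|i i_n|i j i_n j_n|].
- lia.
- by have := LP i i_n; lia.
- by have := LP i i_n; have := LP j j_n; lia.
- move=> i j u v ui vj; rewrite /theta ui vj !consecutive_iota /rooted_digraph !inE.
  have := LP i (ltn_ord i); have := LP j (ltn_ord j).
  move: (i : nat) (j : nat) (L i) (L j) => {ui vj LP L u v} {}i {}j li lj.
  by move=> [[-> ->]|[[-> ->]|[[-> ->]|[[-> ->]|[? ->]]]]]
            [[-> ->]|[[-> ->]|[[-> ->]|[[-> ->]|[? ->]]]]];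
    decide_atoms.
Qed.

(** * Heights above the branching vertices *)

Lemma strongly_connected_outdegree_gt0 n (D : rel 'I_n) x :
  (1 < n)%N -> strongly_connected D -> (0 < outdegree D x)%N.
Proof.
move=> n1 sD; have [y yx] : exists y, y != x.
  have : (0 < #|predC1 x|)%N by rewrite cardC1 card_ord; lia.
  by case/card_gt0P => y; exists y.
have /connectP[[|z p] /= pth lst] := sD x y; first by rewrite lst eqxx in yx.
by apply/card_gt0P; exists z; rewrite inE; case/andP: pth.
Qed.

(* Every vertex outside [B] has outdegree one, so it starts a unique walk, and
   this walk leads to [B]; the height of a vertex is the length of that walk. *)
Section Chains.
Variables (n : nat) (D : rel 'I_n) (B : {set 'I_n}) (p : 'I_n).
Hypotheses (sD : strongly_connected D) (pB : p \in B)
  (outB : forall v, v \notin B -> outdegree D v = 1%N).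

Definition next v := odflt v [pick y | D v y].

Lemma nextE v y : v \notin B -> D v y = (y == next v).
Proof.
move/outB/eqP/cards1P => [z /setP Dz]; have {}Dz u : D v u = (u == z).
  by have := Dz u; rewrite !inE.
rewrite /next; case: pickP => [u|] /=; first by rewrite !Dz => /eqP->.
by move/(_ z); rewrite Dz eqxx.
Qed.

(** A path from [v] to [p] has to follow [next] as long as it stays outside [B]. *)
Lemma ex_iter_next v : exists m, iter m next v \in B.
Proof.
have /connectP[s] := sD v p.
elim: s v => [|y s IH] v /=; first by move=> _ <-; exists 0%N.
case: (boolP (v \in B)) => [vB _ _|vB]; first by exists 0%N.
rewrite nextE // => /andP[/eqP-> pth lst].
by have [m mB] := IH _ pth lst; exists m.+1; rewrite iterSr.
Qed.

Definition height v := ex_minn (ex_iter_next v).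

Lemma iter_height v : iter (height v) next v \in B.
Proof. by rewrite /height; case: ex_minnP. Qed.

Lemma height_min v m : iter m next v \in B -> (height v <= m)%N.
Proof. by rewrite /height; case: ex_minnP => k _ k_min /k_min. Qed.

Lemma iter_lt_height v k : (k < height v)%N -> iter k next v \notin B.
Proof. by apply: contraL => /height_min; rewrite -leqNgt. Qed.

Lemma height_eq0 v : (height v == 0)%N = (v \in B).
Proof.
apply/eqP/idP => [h0|vB]; first by have := iter_height v; rewrite h0.
by apply/eqP; rewrite -leqn0 (@height_min v 0).
Qed.

Lemma height_next v : v \notin B -> height v = (height (next v)).+1.
Proof.
move=> vB; apply/eqP; rewrite eqn_leq height_min ?iterSr ?iter_height //=.
have := vB; rewrite -height_eq0 -lt0n => h0.
by rewrite -(prednK h0) ltnS height_min // -iterSr prednK ?iter_height.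
Qed.

Lemma height_iter v k :
  (k <= height v)%N -> height (iter k next v) = (height v - k)%N.
Proof.
elim: k => [|k IH] kh; first by rewrite subn0.
by have := height_next (iter_lt_height kh); rewrite IH ?(ltnW kh) //=; lia.
Qed.

(** The final vertex, which lies in [B], is left out, so the size of the chain is exactly the
    height. *)
Definition chain v := [set iter k next v | k : 'I_(height v)].

Lemma chainP v u :
  reflect (exists2 k, (k < height v)%N & u = iter k next v) (u \in chain v).
Proof.
apply: (iffP imsetP) => [[k _ ->]|[k kh ->]]; first by exists k.
by exists (Ordinal kh).
Qed.

Lemma chain_height_inj v : {in chain v &, injective height}.
Proof.
move=> _ _ /chainP[k kh ->] /chainP[l lh ->].
rewrite (height_iter (ltnW kh)) (height_iter (ltnW lh)) => kl.
by have -> : k = l by lia.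
Qed.

Lemma card_chain v : #|chain v| = height v.
Proof.
rewrite card_imset ?card_ord // => k l kl; apply: val_inj => /=.
have := congr1 height kl.
rewrite (height_iter (ltnW (ltn_ord k))) (height_iter (ltnW (ltn_ord l))).
by have := ltn_ord k; have := ltn_ord l; lia.
Qed.

Lemma chain_subC v : chain v \subset ~: B.
Proof. by apply/subsetP => _ /chainP[k kh ->]; rewrite inE iter_lt_height. Qed.

Lemma height_le v : (height v <= #|~: B|)%N.
Proof. by rewrite -card_chain subset_leq_card ?chain_subC. Qed.

(* A walk as long as the number of nonbranching vertices visits all of them. *)
Lemma height_full_inj v :
  height v = #|~: B| -> {in ~: B &, injective height}.
Proof.
move=> hv; suff <- : chain v = ~: B by exact: chain_height_inj.
by apply/eqP; rewrite eqEcard chain_subC card_chain hv leqnn.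
Qed.

(* The walk from [f] misses only [g], as heights decrease along it. *)
Lemma height_twins_inj f g : f != g -> height f = height g -> (0 < height g)%N ->
  (height f).+1 = #|~: B| -> {in ~: B :\ g &, injective height}.
Proof.
move=> fg hfg g0 hf; have gB : g \in ~: B by rewrite inE -height_eq0 -lt0n.
suff <- : chain f = ~: B :\ g by exact: chain_height_inj.
apply/eqP; rewrite eqEcard card_chain; apply/andP; split; last first.
  by have := cardsD1 g (~: B); rewrite gB -hf add1n => -[->].
apply/subsetP => u uf; rewrite in_setD1 (subsetP (chain_subC f)) // andbT.
apply: contraNneq fg => ug; move/chainP: uf => [k kh]; rewrite ug => gk.
have := height_iter (ltnW kh); rewrite -gk -hfg => k0.
by have -> : f = g by rewrite gk (_ : k = 0%N) //; lia.
Qed.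

Lemma eigenvector_iter (R : realType) (lam : R) x v k :
  perron_eigenvector D lam x -> (k <= height v)%N ->
  x v * (lam - 1) ^+ k = x (iter k next v).
Proof.
move=> [x0 Dx]; elim: k => [|k IH] kh; first by rewrite expr0 mulr1.
rewrite exprSr mulrA IH; last exact: ltnW.
have kB := iter_lt_height kh; have := Dx (iter k next v).
rewrite outB // (eq_bigl _ _ (fun y => nextE y kB)) big_pred1_eq /=.
by lra.
Qed.

End Chains.

(** An arbitrary vertex [p] plays the part of the branching vertex. The walk from its successor [f]
    back to [p] visits a set closed under arcs, hence everything by strong connectivity. So [f] has
    height [n.-1], and the heights number the vertices as in the normal form of the cycle. *)
Lemma isomorphic_dicycle n (D : rel 'I_n) :
  (1 < n)%N -> strongly_connected D -> (forall v, outdegree D v = 1%N) ->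
  isomorphic D (dicycle n).
Proof.
move=> n1 sD out1; have n0 := ltnW n1.
pose p := Ordinal n0; pose B := [set p].
have pB : p \in B by rewrite inE.
have outB v : v \notin B -> outdegree D v = 1%N by [].
pose h := height sD pB outB; pose f := next D p.
(* Applying [nextE] with the empty set in place of [B] covers [p] as well. *)
have DE u v : D u v = (v == next D u).
  by apply: (@nextE _ _ set0) (fun v _ => out1 v) _ _ _; rewrite in_set0.
have hp : h p = 0%N by apply/eqP; rewrite height_eq0.
have cardB : #|~: B| = n.-1 by rewrite cardsC1 card_ord.
have hf : h f = n.-1.
  apply/eqP; rewrite eqn_leq -{1}cardB height_le /=.
  have closedC u v : D u v -> u \in p |: chain sD pB outB f ->
      v \in p |: chain sD pB outB f.
    rewrite DE => /eqP-> /setU1P[->|/chainP[k kh ->]].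
      have [f0|f0] := posnP (h f).
        by rewrite !inE; have/eqP := f0; rewrite height_eq0 inE => ->.
      by apply/setU1P; right; apply/chainP; exists 0%N.
    have [kh'|kh'] := ltnP k.+1 (h f).
      by apply/setU1P; right; apply/chainP; exists k.+1.
    have := iter_height sD pB outB f.
    rewrite (_ : height _ _ _ _ = k.+1); last first.
      by apply/eqP; rewrite eqn_leq kh kh'.
    by rewrite inE /= => /eqP->; rewrite setU11.
  have : [set: 'I_n] \subset p |: chain sD pB outB f.
    have closed_path s u : u \in p |: chain sD pB outB f -> path D u s ->
        last u s \in p |: chain sD pB outB f.
      by elim: s u => //= y s IH u uC /andP[uy]; apply: IH; exact: closedC uy uC.
    apply/subsetP => v _; have /connectP[s pth ->] := sD p v.
    exact: closed_path (setU11 _ _) pth.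
  move/subset_leq_card; rewrite cardsT card_ord.
  move=> /leq_trans/(_ (leq_card_setU _ _)).
  by rewrite cards1 card_chain -/h; lia.
apply: isomorphic_trans (isomorphic_sym (dicycle_rooted n0)).
have h_inj := height_full_inj (etrans hf (esym cardB)).
apply: (@isomorphic_rooted_digraph _ _ _ _ h p (next D)) => //.
- by move=> v; have := height_le sD pB outB v; rewrite cardB -/h; lia.
- move=> u v huv; have := height_eq0 sD pB outB u; have := height_eq0 sD pB outB v.
  rewrite -/h huv => -> uv; have [uB|uB] := boolP (u \in B).
    by move: (uB); rewrite -uv in uB; move: uB; rewrite !inE => /eqP-> /eqP->.
  by apply: h_inj => //; rewrite inE // uv.
- move=> v; rewrite DE inE -hf; apply/eqP/eqP => [->//|hv].
  apply: h_inj; rewrite ?hv ?hf // inE -(height_eq0 sD pB outB) -/h ?hv ?hf; lia.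
- by move=> u up; rewrite [h u]height_next ?inE.
Qed.

(** * * Recognizing the thetas by heights, and the branching inequality *)

Section TwoBranches.
Variables (n : nat) (D : rel 'I_n) (B : {set 'I_n}) (p f g : 'I_n).
Hypotheses (n4 : (4 <= n)%N) (sD : strongly_connected D) (pB : p \in B)
  (outB : forall v, v \notin B -> outdegree D v = 1%N)
  (fg : f != g) (DpE : forall v, D p v = (v == f) || (v == g)).

Let h := height sD pB outB.

(** The numbering [H] is kept apart from the height [h] because twins of equal height need different
    numbers. *)
Lemma isomorphic_rooted_of_height S par (H : 'I_n -> nat) :
  B = [set p] -> (forall v, H v < n)%N -> {in ~: B &, injective H} ->
  (forall v, (H v == 0)%N = (v == p)) ->
  S =i [:: H f; H g] -> f != p -> g != p ->
  (forall u, u != p -> H (next D u) = par (H u)) ->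
  isomorphic D (rooted_digraph n S par).
Proof.
move=> BE H_lt H_inj H0 SE fp gp Hnx.
have inj_H : injective H.
  move=> u v uv; have [up|up] := eqVneq u p.
    by have := H0 v; rewrite -uv H0 up eqxx => /esym/eqP.
  by apply: H_inj => //; rewrite BE !inE // -H0 -uv H0.
apply: (@isomorphic_rooted_digraph _ _ _ _ H p (next D)) => //.
- by apply/eqP; rewrite H0.
- by move=> v; rewrite SE !inE !(inj_eq inj_H) DpE.
- by move=> u v up; rewrite (nextE outB) // BE inE.
Qed.

(** Walks stay among the [n - #|B|] nonbranching vertices. With two or more branching vertices,
    heights are at most [n - 2], and [f] and [g] cannot both attain this, since a walk of full
    length makes heights injective. With one, [h f = n.-1] leaves theta(0,1,n-3), theta(0,2,n-4) or
    [h g <= n - 4]; a smaller [h f] leaves the twins of theta(1,1,n-4) or [h g <= n - 3]. *)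
Lemma heights_dichotomy :
  (h g <= h f)%N ->
  ~ isomorphic D (rooted_digraph n [:: n.-1; n - 2] predn)%N ->
  ~ isomorphic D (rooted_digraph n [:: n.-1; n - 2] (theta11_parent n))%N ->
  ~ isomorphic D (rooted_digraph n [:: n.-1; n - 3] predn)%N ->
  (h f < n)%N /\
  ((1 <= n.-1 - h f) && (2 <= n.-1 - h g) || (3 <= n.-1 - h g))%N.
Proof.
move=> gf not01 not11 not02.
have hN v : (h v <= #|~: B|)%N by exact: height_le.
have cB : (#|B| + #|~: B| = n)%N by rewrite cardsC card_ord.
have B0 : (0 < #|B|)%N by apply/card_gt0P; exists p.
have inC v : (0 < h v)%N -> v \in ~: B.
  by rewrite inE -(height_eq0 sD pB outB) -/h lt0n.
split; first by have := hN f; lia.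
have [B1|B1] := leqP #|B| 1; last first.
  have hf := hN f; have hg := hN g.
  have [hg2|hg2] := leqP 2 (n.-1 - h g); first by lia.
  exfalso; have hfN : h f = #|~: B| by lia.
  case/eqP: fg; apply: (height_full_inj hfN); rewrite ?inC -/h; lia.
have BE : B = [set p].
  by apply/esym/eqP; rewrite eqEcard sub1set pB cards1.
have h0 v : (h v == 0)%N = (v == p) by rewrite [LHS]height_eq0 BE inE.
have hnx u : u != p -> h u = (h (next D u)).+1.
  by move=> up; rewrite [LHS]height_next // BE inE.
have hlt v : (h v < n)%N by have := hN v; lia.
have cN : #|~: B| = n.-1 by lia.
have [hf1|hf1] := eqVneq (h f) n.-1.
  have h_inj := height_full_inj (etrans hf1 (esym cN)).
  have hgN : h g != n.-1.
    apply: contraNneq fg => hg1; apply/eqP.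
    by apply: h_inj; rewrite ?inC -/h ?hf1 ?hg1; lia.
  have iso S : S =i [:: h f; h g] -> (0 < h g)%N ->
      isomorphic D (rooted_digraph n S predn).
    move=> SE hg0; apply: (isomorphic_rooted_of_height (H := h)) => //.
    - by rewrite -h0; lia.
    - by rewrite -h0; lia.
    - by move=> u /hnx ->.
  have [hg2|hg2] := eqVneq (h g) (n - 2)%N.
    by case: not01; apply: iso; [move=> z; rewrite hf1 hg2|lia].
  have [hg3|hg3] := eqVneq (h g) (n - 3)%N.
    by case: not02; apply: iso; [move=> z; rewrite hf1 hg3|lia].
  by have := hlt g; lia.
have [hg2|hg2] := eqVneq (h g) (n - 2)%N; last by have := hlt f; lia.
have hf2 : h f = (n - 2)%N by have := hlt f; lia.
exfalso; apply: not11.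
have h_inj : {in ~: B :\ g &, injective h}.
  apply: (@height_twins_inj _ _ _ _ sD pB outB f g fg);
    rewrite -/h ?hf2 ?hg2 //; lia.
(* A vertex of height [n.-1] would make heights injective, against [h f = h g]. *)
have h_le v : v \in ~: B -> (h v <= n - 2)%N.
  move=> vB; rewrite leqNgt; apply/negP => hv.
  have hvN : h v = #|~: B| by have := hlt v; lia.
  case/eqP: fg; apply: (height_full_inj hvN); rewrite ?inC -/h ?hf2 ?hg2 //; lia.
pose H v := if v == g then n.-1 else h v.
have gp : g != p by rewrite -h0; lia.
have fp : f != p by rewrite -h0; lia.
apply: (isomorphic_rooted_of_height (H := H)) => //; rewrite /H.
- by move=> v; case: eqP => // _; lia.
- move=> u v uB vB.
  case: (eqVneq u g) => [->|ug]; case: (eqVneq v g) => [->|vg] // huv.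
  + by have := h_le _ vB; lia.
  + by have := h_le _ uB; lia.
  + by apply: h_inj; rewrite // in_setD1 ?ug ?vg.
- by move=> v; case: (eqVneq v g) => [->|_] //; rewrite (negPf gp); lia.
- by move=> z; rewrite (negPf fg) eqxx hf2 !inE orbC.
- move=> u up; have hu := hnx u up; have hun := hlt u.
  (* A nonbranching in-neighbour of [g] would have height [n.-1]. *)
  have -> : (next D u == g) = false.
    apply: contraTF isT => /eqP ug; move: hu; rewrite ug => hu.
    have uC : u \in ~: B by rewrite BE !inE.
    by have := h_le _ uC; lia.
  rewrite /theta11_parent; have [ug|ug] := eqVneq u g.
    by rewrite eqxx; move: hu; rewrite ug hg2; lia.
  have uC : u \in ~: B by rewrite BE !inE.
  by have := h_le _ uC; case: eqP; lia.
Qed.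

End TwoBranches.

Lemma branching_inequality (R : realType) n (D : rel 'I_n) (s := q R D - 1) :
  (4 <= n)%N -> strongly_connected D -> s < 2 ->
  ~ isomorphic D (dicycle n) ->
  ~ isomorphic D (rooted_digraph n [:: n.-1; n - 2] predn)%N ->
  ~ isomorphic D (rooted_digraph n [:: n.-1; n - 2] (theta11_parent n))%N ->
  ~ isomorphic D (rooted_digraph n [:: n.-1; n - 3] predn)%N ->
  1 < s /\ exists a b, s ^+ a + s ^+ b <= (s - 1) * s ^+ n.-1 /\
    ((1 <= a) && (2 <= b) || (3 <= b))%N.
Proof.
move=> n4 sD s2 notC not01 not11 not02.
have [x Dx] := ex_perron_eigenvector R (ltnW (ltnW (ltnW n4))) sD.
have [x0 Dxe] := Dx.
pose B := [set v | outdegree D v != 1%N].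
have outB v : v \notin B -> outdegree D v = 1%N by rewrite inE negbK => /eqP.
have [p0 p0B] : exists p0, p0 \in B.
  apply/set0Pn; apply/negP => /eqP B0; apply: notC; apply: isomorphic_dicycle => //.
    exact: leq_trans n4.
  by move=> v; apply: outB; rewrite B0 inE.
pose p := [arg min_(v < p0 in B) x v]%O.
have [pB p_min] : p \in B /\ forall v, v \in B -> x p <= x v.
  by rewrite /p; case: arg_minP => // v vB vmin.
have out_p : outdegree D p = 2%N.
  have d0 := strongly_connected_outdegree_gt0 p (leq_trans (isT : 1 < 4)%N n4) sD.
  have d1 : outdegree D p != 1%N by move: pB; rewrite inE.
  (* The equation at [p] gives [(q R D - d) * x p > 0] for its outdegree [d], so [d < q R D < 3]. *)
  have d3 : (outdegree D p < 3)%N.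
    rewrite -(ltr_nat R); have := Dxe p; have xp := x0 p.
    have : 0 < \sum_(j | D p j) x j.
      have /card_gt0P[j] := d0; rewrite inE => Dpj.
      by rewrite (bigD1 j) //= ltr_wpDr // sumr_ge0 // => i _; exact: ltW.
    move=> sum0 sumE; rewrite -(ltr_pM2r xp); move: s2; rewrite /s => s2.
    have : (q R D - 1) * x p < 2 * x p by rewrite ltr_pM2r.
    by nra.
  by move: d0 d1 d3; case: outdegree => [|[|[|]]].
have /cards2P[f [g [fg /setP DpE]]] : #|[set y | D p y]| == 2%N by exact/eqP.
have {}DpE v : D p v = (v == f) || (v == g) by have := DpE v; rewrite !inE.
wlog gf : f g fg DpE / (height sD pB outB g <= height sD pB outB f)%N.
  move=> wl.
  case: (leqP (height sD pB outB g) (height sD pB outB f)) => [|/ltnW] gf.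
    exact: wl gf.
  apply: (wl g f) => //; first by rewrite eq_sym.
  by move=> v; rewrite DpE orbC.
have [hfn dich] := heights_dichotomy n4 fg DpE gf not01 not11 not02.
set hf := height sD pB outB f in gf hfn dich; set hg := height _ _ _ g in gf dich.
(* The right-hand side is the value of [x] at the branching vertex where the walk from [v] ends, and
   [p] minimizes [x] on [B]. *)
have xh v : x p <= x v * s ^+ height sD pB outB v.
  by rewrite (eigenvector_iter Dx (leqnn _)); apply: p_min; exact: iter_height.
have root_eq : (s - 1) * x p = x f + x g.
  have := Dxe p.
  rewrite (eq_bigl _ _ DpE) (bigD1 f) ?eqxx //= (big_pred1 g); last first.
    by move=> v /=; have [->|] := eqVneq v f; rewrite ?(negPf fg) //= andbT.
  by rewrite out_p /s; lra.
have s1 : 1 < s.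
  by rewrite -subr_gt0 -(pmulr_lgt0 _ (x0 p)) root_eq addr_gt0.
split=> //; exists (n.-1 - hf)%N, (n.-1 - hg)%N; split=> //.
have s_ge0 : 0 <= s by lra.
rewrite -(ler_pM2r (x0 p)) [leRHS]mulrAC root_eq !mulrDl.
have bound v k : (height sD pB outB v = k)%N -> (k <= n.-1)%N ->
    s ^+ (n.-1 - k) * x p <= x v * s ^+ n.-1.
  move=> hv kn; rewrite -{2}(subnK kn) exprD mulrCA ler_wpM2l ?exprn_ge0 //.
  by rewrite -hv.
by rewrite lerD // bound //; lia.
Qed.

(** * * Comparing the roots of the polynomial equations *)

(** If [t <= s], monotonicity gives [2 = (t - 1) t^(m+1) <= (s - 1) s^(m+1)]; multiplying by [s]
    yields [2 s <= s + 1], against [1 < s]. *)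
Lemma theta01_theta11_lt (R : realFieldType) (s t : R) m : 1 < s -> 1 < t ->
  (s - 1) * s ^+ m.+2 = s + 1 -> (t - 1) * t ^+ m.+2 = 2 * t -> s < t.
Proof.
move=> s1 t1 Es Et; rewrite ltNge; apply/negP => ts.
have : (t - 1) * t ^+ m <= (s - 1) * s ^+ m.
  by rewrite ler_pM ?exprn_ge0 ?lerXn2r ?nnegrE; lra.
move: Es Et; rewrite !exprSr !mulrA; set u := (s - 1) * _; set v := (t - 1) * _.
move=> Es Et vu.
have t_neq0 : t != 0 by rewrite gt_eqF //; lra.
have {}Et : v * t = 2 by apply: (mulIf t_neq0).
have v0 : 0 <= v by rewrite mulr_ge0 ?exprn_ge0; lra.
have : 2 <= u * s by rewrite -Et ler_pM //; lra.
by rewrite -(ler_pM2r (_ : 0 < s)) ?Es; lra.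
Qed.

(** If [t <= s], then [(t - 1) t^(m+1) <= 2], so [1 + t^2 <= 2 t], against [1 < t]. *)
Lemma theta11_theta02_lt (R : realFieldType) (s t : R) m : 1 < s -> 1 < t ->
  (s - 1) * s ^+ m.+2 = 2 * s -> (t - 1) * t ^+ m.+2 = 1 + t ^+ 2 -> s < t.
Proof.
move=> s1 t1 Es Et; rewrite ltNge; apply/negP => ts.
have : (t - 1) * t ^+ m <= (s - 1) * s ^+ m.
  by rewrite ler_pM ?exprn_ge0 ?lerXn2r ?nnegrE; lra.
move: Es Et; rewrite !exprSr !mulrA; set u := (s - 1) * _; set v := (t - 1) * _.
move=> Es Et vu.
have s_neq0 : s != 0 by rewrite gt_eqF //; lra.
have {}Es : u * s = 2 by apply: (mulIf s_neq0).
have v0 : 0 <= v by rewrite mulr_ge0 ?exprn_ge0; lra.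
have : v * t <= 2 by rewrite -Es ler_pM //; lra.
rewrite -(ler_pM2r (_ : 0 < t)) ?Et; last by lra.
by rewrite expr0 mul1r; nra.
Qed.

(** The condition on [a] and [b] makes [t^a + t^b] exceed [1 + t^2]. With [u = (s - 1) s^m] and
    [v = (t - 1) t^m], this gives [(u - 1) s^2 = 1 < (v - 1) t^2], whereas [t <= s] would give the
    reverse inequality. *)
Lemma theta02_extremal_lt (R : realFieldType) (s t : R) m a b : 1 < s -> 1 < t ->
  (s - 1) * s ^+ m.+2 = 1 + s ^+ 2 -> t ^+ a + t ^+ b <= (t - 1) * t ^+ m.+2 ->
  ((1 <= a) && (2 <= b) || (3 <= b))%N -> s < t.
Proof.
move=> s1 t1 Es Et ab; rewrite ltNge; apply/negP => ts.
have t0 : 0 < t by lra.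
have {ab Et} Et : 1 + t ^+ 2 < (t - 1) * t ^+ m.+2.
  apply: lt_le_trans Et; case/orP: ab => [/andP[a1 b2]|b3].
    by rewrite ltr_leD ?exprn_egt1 ?ler_weXn2l ?ltW // -lt0n.
  by rewrite ler_ltD ?exprn_ege1 ?ltr_eXn2l ?ltW.
have : (t - 1) * t ^+ m <= (s - 1) * s ^+ m.
  by rewrite ler_pM ?exprn_ge0 ?lerXn2r ?nnegrE; lra.
move: Es Et; rewrite !exprSr expr0 !mul1r !mulrA.
set u := (s - 1) * _; set v := (t - 1) * _ => Es Et vu.
have tt : t * t <= s * s by rewrite ler_pM //; lra.
have v1 : 1 < v.
  by rewrite -(ltr_pM2r (_ : 0 < t * t)) ?mulr_gt0 // mul1r; lra.
have : (v - 1) * (t * t) <= (u - 1) * (s * s).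
  by rewrite ler_pM // ?mulr_ge0 //; lra.
lra.
Qed.

(** For [s >= 2] the left-hand side is at least [s^3], which exceeds [1 + s^2]. This disposes of
    every digraph with [q - 1 >= 2], where branching vertices may have outdegree above two. *)
Lemma theta02_root_lt2 (R : realFieldType) (s : R) m : 1 < s ->
  (s - 1) * s ^+ m.+3 = 1 + s ^+ 2 -> s < 2.
Proof.
move=> s1 Es; rewrite ltNge; apply/negP => s2.
have sm : 1 <= s ^+ m by rewrite exprn_ege1 // ltW.
have : s * s * s <= (s - 1) * s ^+ m.+3.
  rewrite !exprSr !mulrA -[leLHS]mul1r !mulrA !ler_wpM2r ?mulr_ege1 //; lra.
by rewrite Es expr2; nra.
Qed.

(** * * Admissibility of the four digraphs, and the conclusion *)

Lemma strongly_connected_path_rooted n S :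
  n.-1 \in S -> strongly_connected (rooted_digraph n S predn).
Proof.
move=> nS; apply: rooted_digraph_strongly_connected => [i|j] jn; first by lia.
have [->|j1] := eqVneq j n.-1; [by left | right].
by exists j.+1; rewrite //; lia.
Qed.

Lemma strongly_connected_theta11_rooted n : (4 <= n)%N ->
  strongly_connected (rooted_digraph n [:: n.-1; n - 2] (theta11_parent n))%N.
Proof.
move=> n4; apply: rooted_digraph_strongly_connected => [i|j] jn.
  by rewrite /theta11_parent; case: eqP; lia.
have [j1|j1] := leqP (n - 2)%N j; [left | right].
  by rewrite !inE; lia.
by exists j.+1; rewrite /theta11_parent; [lia | case: eqP; lia].
Qed.

Lemma simple_rooted_digraph n S par :
  0%N \notin S -> (forall i, 0 < i < n -> par i < i)%N ->
  simple_digraph (rooted_digraph n S par).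
Proof.
move=> S0 par_lt i; rewrite /rooted_digraph; have [->|i0] := eqVneq (i : nat) 0%N.
  exact: negbTE.
by apply: gtn_eqF; apply: par_lt; rewrite lt0n i0 ltn_ord.
Qed.

Lemma q_dicycle (R : realType) n : (1 < n)%N -> q R (dicycle n) = 2.
Proof.
move=> n1; have n0 := ltnW n1.
apply: (@q_perron_eigenvector _ _ _ _ (fun=> 1)) => //; split=> // i.
pose j := Ordinal (ltn_pmod i.+1 n0).
have Dj k : dicycle n i k = (k == j) by [].
rewrite (eq_bigl _ _ Dj) big_pred1_eq /outdegree.
have -> : #|[set y | dicycle n i y]| = 1%N.
  by rewrite -(cards1 j); apply: eq_card => k; rewrite !inE.
by rewrite !mulr1.
Qed.

Theorem theorem5p4 (R : realType) (n : nat) (n_ge4 : (4 <= n)%N) :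
  [/\ simple_digraph (dicycle n) /\ strongly_connected (dicycle n),
      simple_digraph (theta 0 1 (n - 3)) /\
        strongly_connected (theta 0 1 (n - 3)),
      simple_digraph (theta 1 1 (n - 4)) /\
        strongly_connected (theta 1 1 (n - 4))
    & simple_digraph (theta 0 2 (n - 4)) /\
        strongly_connected (theta 0 2 (n - 4))] /\
  [/\ q R (dicycle n) < q R (theta 0 1 (n - 3)),
      q R (theta 0 1 (n - 3)) < q R (theta 1 1 (n - 4)),
      q R (theta 1 1 (n - 4)) < q R (theta 0 2 (n - 4))
    & forall D : rel 'I_n,
        simple_digraph D -> strongly_connected D ->
        ~ isomorphic D (dicycle n) ->
        ~ isomorphic D (theta 0 1 (n - 3)) ->
        ~ isomorphic D (theta 1 1 (n - 4)) ->
        ~ isomorphic D (theta 0 2 (n - 4)) ->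
        q R (theta 0 2 (n - 4)) < q R D].
Proof.
have n0 : (0 < n)%N by lia.
have path_lt i : (0 < i < n -> i.-1 < i)%N by lia.
have parent_lt i : (0 < i < n -> theta11_parent n i < i)%N.
  by rewrite /theta11_parent; case: eqP; lia.
have isoC := dicycle_rooted n0; have iso01 := theta01_rooted n_ge4.
have iso11 := theta11_rooted n_ge4; have iso02 := theta02_rooted n_ge4.
have sC := @strongly_connected_path_rooted n [:: n.-1] (mem_head _ _).
have s01 := @strongly_connected_path_rooted n [:: n.-1; n - 2]%N (mem_head _ _).
have s02 := @strongly_connected_path_rooted n [:: n.-1; n - 3]%N (mem_head _ _).
have s11 := strongly_connected_theta11_rooted n_ge4.
have transfer m (E : rel 'I_m) S par : isomorphic E (rooted_digraph n S par) ->
    strongly_connected (rooted_digraph n S par) -> 0%N \notin S ->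
    (forall i, 0 < i < n -> par i < i)%N ->
    simple_digraph E /\ strongly_connected E.
  move=> /isomorphic_sym iso sG S0 par_lt; split.
    exact: isomorphic_simple iso (simple_rooted_digraph S0 par_lt).
  exact: isomorphic_strongly_connected iso sG.
split.
  by split; [apply: transfer isoC sC _ _ | apply: transfer iso01 s01 _ _
    | apply: transfer iso11 s11 _ _ | apply: transfer iso02 s02 _ _];
    rewrite // !inE; lia.
have [t01 e01] : let s := q R (theta 0 1 (n - 3)) - 1 in
    1 < s /\ (s - 1) * s ^+ n.-1 = s + 1.
  rewrite (isomorphic_q _ _ iso01) //.
  (* With parent [predn], the number of a vertex is its distance to the root, so the height function
     is [id]. *)
  have [|||||||t e] := @rooted_digraph_q R n n.-1 (n - 2) n.-1 predn id s01; try lia.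
  split=> //; rewrite e subnn expr0 (_ : n.-1 - (n - 2) = 1)%N; last by lia.
  by rewrite expr1 addrC.
have [t02 e02] : let s := q R (theta 0 2 (n - 4)) - 1 in
    1 < s /\ (s - 1) * s ^+ n.-1 = 1 + s ^+ 2.
  rewrite (isomorphic_q _ _ iso02) //.
  have [|||||||t e] := @rooted_digraph_q R n n.-1 (n - 3) n.-1 predn id s02; try lia.
  split=> //; rewrite e subnn expr0 (_ : n.-1 - (n - 3) = 2)%N; [|lia]. done.
have [t11 e11] : let s := q R (theta 1 1 (n - 4)) - 1 in
    1 < s /\ (s - 1) * s ^+ n.-1 = 2 * s.
  rewrite (isomorphic_q _ _ iso11) //.
  (* The twin numbered [n.-1] is at distance [n - 2] from the root, like the vertex [n - 2]. *)
  pose ht i := if (i == n.-1)%N then (n - 2)%N else i.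
  have hta : ht n.-1 = (n - 2)%N by rewrite /ht eqxx.
  have htb : ht (n - 2)%N = (n - 2)%N by rewrite /ht; case: eqP; lia.
  have [|||||||t e] := @rooted_digraph_q R n n.-1 (n - 2) n.-1 _ ht s11.
  - by lia.
  - by lia.
  - by rewrite hta; lia.
  - by rewrite htb; lia.
  - exact: parent_lt.
  - by rewrite /ht; case: eqP; lia.
  - by move=> i i_n; rewrite /ht /theta11_parent; repeat case: eqP; lia.
  split=> //; rewrite e hta htb (_ : n.-1 - (n - 2) = 1)%N; last by lia.
  by rewrite expr1; ring.
(* This exhibits the exponent in the shapes [m.+2] and [m.+3] of the root comparisons. *)
have n_eq : n.-1 = (n - 4).+3 by lia.
move: e01 e02 e11; rewrite n_eq => e01 e02 e11.
have lt1 := theta01_theta11_lt t01 t11 e01 e11.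
have lt2 := theta11_theta02_lt t11 t02 e11 e02.
have shift (x y : R) : x - 1 < y - 1 -> x < y by rewrite ltrD2r.
split; [|exact: shift lt1|exact: shift lt2|].
  rewrite q_dicycle; last by lia.
  by rewrite -[2]/(1 + 1) -ltrBrDr; exact: t01.
move=> D _ sD notC not01 not11 not02; apply: shift.
have [s_ge2|s_lt2] := leP 2 (q R D - 1).
  exact: lt_le_trans (theta02_root_lt2 t02 e02) s_ge2.
have iso_ok k (E : rel 'I_k) S par : isomorphic E (rooted_digraph n S par) ->
    ~ isomorphic D E -> ~ isomorphic D (rooted_digraph n S par).
  move=> iso notE isoD; apply: notE.
  exact: isomorphic_trans isoD (isomorphic_sym iso).
have [s1 [a [b [Dab ab]]]] := branching_inequality n_ge4 sD s_lt2 notC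
  (iso_ok _ _ _ _ iso01 not01) (iso_ok _ _ _ _ iso11 not11)
  (iso_ok _ _ _ _ iso02 not02).
rewrite n_eq in Dab.
exact: theta02_extremal_lt t02 s1 e02 Dab ab.
Qed.
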